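(* Let $n\ge2$ and let $\{\Gamma_a\}_{a\in[1,2]}$ be one of the following three families in $\mathbb{R}^n=\mathbb{R}^{n-1}\times\mathbb{R}$: $$S_a=\{(X,y):|X|^2+y^2=a^2\},\quad \mathcal{P}_a^0=\{(X,y):y=a|X|^2,\ |X|\le1\},\quad \mathcal{C}_a^0=\{(X,y):y=a|X|,\ |X|\le1\}.$$ Then there is a constant $C$ depending only on $n$ such that for every $\delta\in(0,1/2)$ there exists a compact set $E\subseteq\mathbb{R}^n$ that contains a translated copy of $\Gamma_a$ for each $a\in[1,2]$ and satisfies $$|E(\delta)|\le C|\log\delta|^{-1}.$$
   Context: For $E\subseteq\mathbb{R}^n$, $E(\delta)=\{x+y:x\in E,\ |y|<\delta\}$ is the $\delta$-neighbourhood, and $|E|$ denotes Lebesgue measure. *)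

(* Defs.v *)
From mathcomp Require Import all_boot all_order all_algebra.
From mathcomp Require Import all_classical all_reals all_analysis.
Import Order.TTheory GRing.Theory Num.Theory.
Import numFieldNormedType.Exports.

Set Implicit Arguments.
Unset Strict Implicit.
Unset Printing Implicit Defensive.

Local Open Scope classical_set_scope.
Local Open Scope ring_scope.

(* The library norm `|v| on matrices is the sup norm; it induces the same
   topology as the Euclidean norm, so [compact] can be used unchanged. *)
Definition enorm (R : realType) (n : nat) (v : 'rV[R]_n) : R :=
  Num.sqrt (\sum_(i < n) v 0 i ^+ 2).

Definition neighbourhood (R : realType) (n : nat) (E : set 'rV[R]_n)
    (delta : R) : set 'rV[R]_n :=
  [set x + y | x in E & y in [set y | enorm y < delta]].

Definition box (R : realType) (n : nat) (a b : 'rV[R]_n) : set 'rV[R]_n :=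
  [set x | forall i, a 0 i <= x 0 i <= b 0 i].

Definition box_volume (R : realType) (n : nat) (a b : 'rV[R]_n) : R :=
  \prod_(i < n) (b 0 i - a 0 i).

Definition box_cover (R : realType) (n : nat) (A : set 'rV[R]_n)
    (a b : nat -> 'rV[R]_n) : Prop :=
  (forall k i, a k 0 i <= b k 0 i) /\ A `<=` \bigcup_k box (a k) (b k).

(* n-dimensional Lebesgue measure, as the outer measure generated by boxes. It
   is the Lebesgue measure on Lebesgue measurable sets, in particular on the
   sets [neighbourhood E delta], which are open. *)
Definition lebesgue_rV (R : realType) (n : nat) (A : set 'rV[R]_n) : \bar R :=
  ereal_inf [set v : \bar R | exists a b : nat -> 'rV[R]_n,
    box_cover A a b /\ v = (\sum_(k <oo) (box_volume (a k) (b k))%:E)%E].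

(* A point (X, y) of R^m x R is a row vector p of length m + 1. *)
Definition Xpart (R : realType) (m : nat) (p : 'rV[R]_(m + 1)) : 'rV[R]_m :=
  lsubmx p.

Definition ypart (R : realType) (m : nat) (p : 'rV[R]_(m + 1)) : R :=
  rsubmx p 0 0.

Definition sphere (R : realType) (m : nat) (a : R) : set 'rV[R]_(m + 1) :=
  [set p | enorm (Xpart p) ^+ 2 + ypart p ^+ 2 = a ^+ 2].

Definition paraboloid (R : realType) (m : nat) (a : R) : set 'rV[R]_(m + 1) :=
  [set p | ypart p = a * enorm (Xpart p) ^+ 2 /\ enorm (Xpart p) <= 1].

Definition cone (R : realType) (m : nat) (a : R) : set 'rV[R]_(m + 1) :=
  [set p | ypart p = a * enorm (Xpart p) /\ enorm (Xpart p) <= 1].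

(* Main.v *)
Require Import Defs.
From mathcomp Require Import all_boot all_order all_algebra.
From mathcomp Require Import all_classical all_reals all_analysis.
From mathcomp Require Import lra ring.
Import Order.TTheory GRing.Theory Num.Theory.
Import numFieldNormedType.Exports.

Local Open Scope classical_set_scope.
Local Open Scope ring_scope.

(** Near a point where the surface is a graph over the hyperplane orthogonal to
   axis i, increasing a by da moves the surface along axis i by m da, for a
   bounded slope m; a translation with dt = - m da along axis i cancels this to
   first order. Let t(a) be a sum of sawtooth functions of periods 2^-k whose
   slopes, added up to the scale j, follow a slowly varying path v_j with steps
   O(1/N) that goes through all of [-K, K] along each coordinate axis in turn.
   For every point of every surface some scale j satisfies v_j = - m + O(1/N)
   along the relevant axis and v_j = 0 along the other axes; at that scale all
   the copies with a in one dyadic interval of length 2^-j agree up to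
   O(2^-j / N), so their union is 1/N times smaller than expected. The quadratic
   error 4^-j is at most 2^-j / N because the path only starts to move at
   scales j >= N. The construction uses O(N) scales, so N can be of
   order |log delta|.
   For spheres one uses the 2n pieces on which a coordinate is bounded away
   from 0, for the other two families the single graph over R^(n-1). *)

(** * Finite box covers and their total volume *)

Section BoxCovers.
Context {R : realType} {d : nat}.
Implicit Types (A : set 'rV[R]_d) (s : seq ('rV[R]_d * 'rV[R]_d)).

Definition box_coverable A (c : R) :=
  exists s, [/\ forall ab, ab \in s -> forall i, ab.1 0 i <= ab.2 0 i,
    A `<=` [set x | exists2 ab, ab \in s & box ab.1 ab.2 x] &
    \sum_(ab <- s) box_volume ab.1 ab.2 <= c].

Lemma box_volume_ge0 (a b : 'rV[R]_d) :
  (forall i, a 0 i <= b 0 i) -> 0 <= box_volume a b.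
Proof. by move=> ab; apply: prodr_ge0 => i _; rewrite subr_ge0. Qed.

(** The list is padded to a sequence by the degenerate box at the origin. Its volume is 0 because
    [0 < d]; in dimension 0 the empty product would be 1. *)
Lemma lebesgue_rV_coverable A (c : R) : (0 < d)%N ->
  box_coverable A c -> (lebesgue_rV A <= c%:E)%E.
Proof.
move=> d0 [s [s_le As sc]].
pose f k := nth (0, 0) s k.
have f_le k i : (f k).1 0 i <= (f k).2 0 i.
  rewrite /f; have [ks|sk] := ltnP k (size s); first exact/s_le/mem_nth.
  by rewrite nth_default.
apply: (@le_trans _ _ (\sum_(k <oo) (box_volume (f k).1 (f k).2)%:E)%E).
  apply: ereal_inf_lbound; exists (fun k => (f k).1), (fun k => (f k).2).
  split=> //; split=> // x /As[ab abs xab]; exists (index ab s) => //=.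
  by rewrite /f nth_index.
rewrite (nneseries_split 0%N (size s)); last first.
  by move=> k _; rewrite lee_fin box_volume_ge0.
rewrite eseries0 ?adde0; last first.
  move=> k; rewrite add0n => sk _; rewrite /f nth_default //=.
  rewrite /box_volume (bigD1 (Ordinal d0)) //= subrr mul0r //.
rewrite add0n sumEFin lee_fin; apply: le_trans sc.
by rewrite (big_nth (0, 0)).
Qed.

Lemma box_coverable0 : box_coverable set0 0.
Proof. by exists [::]; split => //; rewrite big_nil. Qed.

Lemma box_coverableU A B (a b : R) : box_coverable A a ->
  box_coverable B b -> box_coverable (A `|` B) (a + b).
Proof.
move=> [s [s1 s2 s3]] [t [t1 t2 t3]]; exists (s ++ t); split.
- by move=> ab; rewrite mem_cat => /orP[/s1|/t1].
- move=> x [/s2|/t2] [ab h hx]; exists ab => //; rewrite mem_cat h ?orbT //.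
- by rewrite big_cat lerD.
Qed.

Lemma box_coverable_le A B (a b : R) : A `<=` B -> b <= a ->
  box_coverable B b -> box_coverable A a.
Proof.
move=> AB ba [s [s1 s2 s3]]; exists s; split => //.
- by move=> x /AB/s2.
- exact: le_trans ba.
Qed.

(** Labels sit on the data [z] rather than on the point [P z], since one point may arise from
    several parameters [a]. *)
Lemma box_coverable_fibers {T : Type} (I : finType) (P : T -> 'rV[R]_d)
    (D : set T) (label : T -> I -> Prop) (c : R) :
  (forall z, D z -> exists i, label z i) ->
  (forall i, box_coverable (P @` [set z | D z /\ label z i]) c) ->
  box_coverable (P @` D) (#|I|%:R * c).
Proof.
move=> lab cov.
suff H (s : seq I) : box_coverable
    (P @` [set z | D z /\ exists2 i, i \in s & label z i]) ((size s)%:R * c).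
  have := H (enum I); rewrite -cardE; apply: box_coverable_le => // _ [z Dz <-].
  by exists z => //; split => //; have [i zi] := lab z Dz; exists i;
    rewrite ?mem_enum.
elim: s => [|i s IH].
  apply: box_coverable_le box_coverable0; last by rewrite mul0r.
  by move=> x [z [_ [i]]].
have := box_coverableU _ _ _ _ (cov i) IH; apply: box_coverable_le.
  move=> x [z [Dz [k]]]; rewrite in_cons => /orP[/eqP->|ks] zk <-.
    by left; exists z.
  by right; exists z => //; split => //; exists k.
by rewrite /= -natr1 mulrDl mul1r addrC.
Qed.

(** One box centred at any point of [A], with the allowed oscillations as half-widths, suffices;
    doubling each side gives [2 ^+ d]. *)
Lemma box_coverable_diam A (i : 'I_d) (e l : R) : 0 <= e -> 0 <= l ->
  (forall p q, A p -> A q -> forall k, k != i -> `|p 0 k - q 0 k| <= e) ->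
  (forall p q, A p -> A q -> `|p 0 i - q 0 i| <= l) ->
  box_coverable A (2 ^+ d * (e ^+ d.-1 * l)).
Proof.
move=> e0 l0 Ae Al; have [[p Ap]|nA] := pselect (exists p, A p); last first.
  apply: box_coverable_le box_coverable0.
    by move=> p Ap; case: nA; exists p.
  by rewrite !mulr_ge0 ?exprn_ge0.
pose r k := if k == i then l else e.
have r0 k : 0 <= r k by rewrite /r; case: ifP.
exists [:: (\row_k (p 0 k - r k), \row_k (p 0 k + r k))]; split.
- by move=> ab; rewrite inE => /eqP -> k /=; rewrite !mxE; have := r0 k; lra.
- move=> q Aq; eexists; first by rewrite inE.
  move=> k /=; rewrite !mxE -ler_distlC distrC /r; case: eqP => [->|/eqP ki].
    exact: Al.
  exact: Ae.
- rewrite big_seq1 /box_volume /=.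
  rewrite (eq_bigr (fun k => 2 * r k)); last by move=> k _; rewrite !mxE; ring.
  rewrite big_split /= prodr_const card_ord ler_wpM2l ?exprn_ge0 //.
  rewrite (bigD1 i) //= /r eqxx mulrC ler_wpM2r //.
  rewrite (eq_bigr (fun=> e)) => [|k /negPf -> //].
  by rewrite prodr_const cardC1 card_ord.
Qed.

End BoxCovers.

(** * Dyadic intervals and sums of sawtooth functions *)

Section Sawtooth.
Context {R : realType}.
Implicit Types (x y : R) (v : nat -> R) (j k J : nat).

Definition dyad k x : nat := Num.truncn (2 ^+ k * x).

Definition saw k x : R := x - (dyad k x)%:R / 2 ^+ k.

Definition sawsum v J x : R := \sum_(0 <= k < J) (v k.+1 - v k) * saw k x.

(** Dyadic intervals are nested: points sharing one at scale [k] share one at every coarser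
    scale. *)
Lemma dyad_div j k x : 0 <= x -> (j <= k)%N ->
  dyad j x = (dyad k x %/ 2 ^ (k - j))%N.
Proof.
move=> x0 jk; rewrite /dyad; set q := Num.truncn (2 ^+ k * x).
set m := (2 ^ (k - j))%N; have m0 : (0 < m)%N by rewrite expn_gt0.
have mE : 2 ^+ k * x = m%:R * (2 ^+ j * x).
  by rewrite /m natrX mulrA -exprD subnK.
have /andP[ql qu] : q%:R <= 2 ^+ k * x < q.+1%:R.
  by rewrite truncn_itv // mulr_ge0 ?exprn_ge0.
apply: truncn_def; rewrite -(ler_pM2l (x := m%:R)) ?ltr0n //.
rewrite -[X in _ && X](ltr_pM2l (x := m%:R)) ?ltr0n // -mE -!natrM.
apply/andP; split.
  by apply: le_trans ql; rewrite ler_nat mulnC leq_divM.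
by apply: lt_le_trans qu _; rewrite ler_nat mulnC ltn_ceil.
Qed.

Lemma saw_ge0_lt k x : 0 <= x -> 0 <= saw k x < 2 ^- k.
Proof.
move=> x0; have /andP[ql qu] : (dyad k x)%:R <= 2 ^+ k * x < (dyad k x).+1%:R.
  by rewrite truncn_itv // mulr_ge0 ?exprn_ge0.
have p0 : 0 < 2 ^+ k :> R by rewrite exprn_gt0.
have -> : saw k x = (2 ^+ k * x - (dyad k x)%:R) / 2 ^+ k.
  by rewrite /saw; field; rewrite gt_eqF.
rewrite divr_ge0 ?subr_ge0 // ?ltW // -[ltRHS]mul1r ltr_pM2r ?invr_gt0 //.
by rewrite ltrBlDl natr1.
Qed.

Lemma saw_dist k x y : 0 <= x -> 0 <= y -> `|saw k x - saw k y| <= 2 ^- k.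
Proof.
move=> /(saw_ge0_lt k) ? /(saw_ge0_lt k) ?; rewrite ler_norml; lra.
Qed.

Lemma dyad_dist j x y : 0 <= x -> 0 <= y -> dyad j x = dyad j y ->
  `|x - y| <= 2 ^- j.
Proof.
move=> x0 y0 xy; have := saw_dist j x y x0 y0; rewrite /saw xy.
by rewrite opprB addrA subrK.
Qed.

Lemma sum_half_le j J : \sum_(j <= k < J) 2 ^- k <= 2 * 2 ^- j :> R.
Proof.
have [jJ|Jj] := leqP j J; last first.
  by rewrite big_geq ?mulr_ge0 ?invr_ge0 ?exprn_ge0 // ltnW.
have J0 : 0 <= 2 ^- J :> R by rewrite invr_ge0 exprn_ge0.
(* Subtracting the missing tail of the geometric series makes the bound inductive in [J - j]. *)
suff : \sum_(j <= k < J) 2 ^- k <= 2 * 2 ^- j - 2 * 2 ^- J :> R by lra.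
rewrite -(subnKC jJ); elim: (J - j)%N => [|m IH].
  by rewrite addn0 big_geq // subrr.
rewrite addnS big_nat_recr ?leq_addr //=; apply: le_trans (lerD IH (lexx _)) _.
by rewrite exprS invfM; lra.
Qed.

Lemma sawsum_le v c J x : (forall k, `|v k.+1 - v k| <= c) -> 0 <= x ->
  `|sawsum v J x| <= 2 * c.
Proof.
move=> vc x0; apply: le_trans (ler_norm_sum _ _ _) _.
have c0 : 0 <= c by apply: le_trans (vc 0%N).
apply: (@le_trans _ _ (\sum_(0 <= k < J) c * 2 ^- k)).
  apply: ler_sum => k _; rewrite normrM ler_pM //.
  have /andP[s0 /ltW s1] := saw_ge0_lt k x x0; by rewrite ger0_norm.
rewrite -mulr_sumr mulrC ler_wpM2r //.
by apply: le_trans (sum_half_le 0 J) _; rewrite expr0 invr1 mulr1.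
Qed.

(* The first j teeth are affine on a dyadic interval of length 2^-j, where
   their slopes telescope to v j; the remaining ones contribute O(c 2^-j). *)
Lemma sawsum_dyad v c j J x y : (forall k, `|v k.+1 - v k| <= c) ->
  v 0%N = 0 -> (j <= J)%N -> 0 <= x -> 0 <= y -> dyad j x = dyad j y ->
  `|sawsum v J x - sawsum v J y - v j * (x - y)| <= 2 * c * 2 ^- j.
Proof.
move=> vc v0 jJ x0 y0 xy; have c0 : 0 <= c by apply: le_trans (vc 0%N).
have -> : sawsum v J x - sawsum v J y - v j * (x - y) =
    \sum_(j <= k < J) (v k.+1 - v k) * (saw k x - saw k y).
  rewrite /sawsum -sumrB.
  under eq_bigr do rewrite -mulrBr.
  rewrite (@big_cat_nat _ _ _ j) //=.
  suff -> : \sum_(0 <= k < j) (v k.+1 - v k) * (saw k x - saw k y) =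
      v j * (x - y) by rewrite addrAC subrr add0r.
  have {1}-> : v j = v j - v 0%N by rewrite v0 subr0.
  rewrite -(telescope_sumr v (leq0n j)) mulr_suml.
  apply: eq_big_nat => k /andP[_ /ltnW kj]; congr (_ * _).
  rewrite /saw (dyad_div k j x) // (dyad_div k j y) // xy.
  by rewrite opprB addrA subrK.
apply: le_trans (ler_norm_sum _ _ _) _.
apply: (@le_trans _ _ (\sum_(j <= k < J) c * 2 ^- k)).
  by apply: ler_sum => k _; rewrite normrM ler_pM ?saw_dist.
by rewrite -mulr_sumr -mulrA mulrCA ler_wpM2l // sum_half_le.
Qed.

End Sawtooth.

(** * The path of slopes and its discretization *)

Section SlopePath.
Context {R : realType}.
Implicit Types (u w m rho : R) (N i k : nat).

Definition tri u : R := Num.max 0 (1 - `|u|).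

(* Coordinate i is active only for u in [4i+4, 4i+8], where the slope runs
   through all of [-rho, rho]. *)
Definition slope_path rho i u : R :=
  rho * (tri (u - (4 * i + 5)%:R) - tri (u - (4 * i + 7)%:R)).

Lemma tri_lip u w : `|tri u - tri w| <= `|u - w|.
Proof.
have uw : `| `|u| - `|w| | <= `|u - w| := ler_dist_dist u w.
rewrite /tri; move: uw (ler_norml (`|u| - `|w|) `|u - w|) => -> /esym/andP[].
rewrite ler_norml; case: (ltP 0 (1 - `|u|)); case: (ltP 0 (1 - `|w|)) => *; lra.
Qed.

Lemma tri0 u : 1 <= `|u| -> tri u = 0.
Proof. by move=> u1; rewrite /tri max_l // subr_le0. Qed.

Lemma slope_path_lip rho i u w : 0 <= rho ->
  `|slope_path rho i u - slope_path rho i w| <= 2 * rho * `|u - w|.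
Proof.
move=> r0; rewrite /slope_path -mulrBr normrM ger0_norm // [2 * _]mulrC -mulrA.
rewrite ler_wpM2l //.
have := tri_lip (u - (4 * i + 5)%:R) (w - (4 * i + 5)%:R).
have := tri_lip (u - (4 * i + 7)%:R) (w - (4 * i + 7)%:R).
by rewrite !opprB ![_ + (_ - w)]addrA !subrK !ler_norml; lra.
Qed.

Lemma slope_path_init rho i u : u <= 4 -> slope_path rho i u = 0.
Proof.
move=> u4; have i0 : 0 <= i%:R :> R by [].
by rewrite /slope_path !tri0 ?subrr ?mulr0 // ler_normr !natrD;
  apply/orP; right; lra.
Qed.

(** The active intervals of distinct coordinates meet at endpoints at most. The range may stop at
    [4i+7], where coordinate [i] has already reached [- rho]. *)
Lemma slope_path_other rho i k u : i != k ->
  (4 * i + 4)%:R <= u <= (4 * i + 7)%:R -> slope_path rho k u = 0.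
Proof.
rewrite neq_ltn => ik ui; rewrite /slope_path !tri0 ?subrr ?mulr0 //.
all: rewrite ler_normr; case/orP: ik; rewrite -(ler_nat R) -natr1 => ik.
all: move: ui; rewrite !natrD => ui; apply/orP; by [left; lra|right; lra].
Qed.

Lemma slope_path_surj rho i m : 0 < rho -> `|m| <= rho ->
  exists2 u, (4 * i + 4)%:R <= u <= (4 * i + 7)%:R & slope_path rho i u = - m.
Proof.
move=> r0; rewrite ler_norml => /andP[m1 m2].
have mr1 : - 1 <= m / rho by rewrite ler_pdivlMr // mulN1r.
have mr2 : m / rho <= 1 by rewrite ler_pdivrMr // mul1r.
have mE : m = rho * (m / rho) by field; rewrite gt_eqF.
move: mr1 mr2 mE; set t := m / rho => t1 t2 mE.
(* For [m <= 0] the value [- m] is taken while the path rises from 0 to [rho], otherwise while it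
   falls from 0 to [- rho]. *)
have [t0|t0] := leP t 0.
- exists ((4 * i + 4)%:R - t); first by rewrite !natrD; lra.
  rewrite /slope_path [X in _ - X]tri0; last first.
    by rewrite ler_normr !natrD; apply/orP; right; lra.
  rewrite /tri ler0_norm; last by rewrite !natrD; lra.
  by rewrite max_r !natrD; [rewrite mE; ring|lra].
- exists ((4 * i + 6)%:R + t); first by rewrite !natrD; lra.
  rewrite /slope_path [X in X - _]tri0; last first.
    by rewrite ler_normr !natrD; apply/orP; left; lra.
  rewrite /tri ler0_norm; last by rewrite !natrD; lra.
  by rewrite max_r !natrD; [rewrite mE; ring|lra].
Qed.

(** If the path equals [- m] at [u], take for [j] the integer part of [N u]. Rounding moves [u] by
    less than [1/N], which the Lipschitz constant [2 rho] turns into the stated error, and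
    [u >= 4i+4] gives [N <= j]. *)
Lemma slope_path_hit rho N i m : (0 < N)%N -> 0 < rho -> `|m| <= rho ->
  exists j, [/\ (N <= j)%N, (j <= N * (4 * i + 7))%N,
    `|slope_path rho i (j%:R / N%:R) + m| <= 2 * rho / N%:R &
    forall k, k != i -> slope_path rho k (j%:R / N%:R) = 0].
Proof.
move=> N0 r0 /(slope_path_surj rho i m r0)[u ui um].
have NR : 0 < N%:R :> R by rewrite ltr0n.
have u0 : 0 <= u by case/andP: ui => + _; apply: le_trans.
have /andP[jl ju] := truncn_itv (mulr_ge0 (ltW NR) u0).
set j := Num.truncn _ in jl ju; exists j.
have jl' : j%:R / N%:R <= u by rewrite ler_pdivrMr // mulrC.
have ju' : u < j%:R / N%:R + N%:R^-1.
  by rewrite -[X in _ + X]mul1r -mulrDl natr1 ltr_pdivlMr // mulrC.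
have jge : (N * (4 * i + 4) <= j)%N.
  rewrite truncn_ge_nat ?mulr_ge0 // natrM ler_wpM2l //; by case/andP: ui.
have jle : (j <= N * (4 * i + 7))%N.
  rewrite -(ler_nat R); apply: le_trans jl _; rewrite natrM ler_wpM2l //.
  by case/andP: ui.
split => //.
- by apply: leq_trans jge; rewrite leq_pmulr // addn4.
- rewrite -[m]opprK -um; apply: le_trans (slope_path_lip _ _ _ _ (ltW r0)) _.
  by rewrite ler_wpM2l ?mulr_ge0 ?(ltW r0) // ler_norml; lra.
- move=> k ki; apply: (@slope_path_other _ i); first by rewrite eq_sym.
  rewrite ler_pdivlMr // ler_pdivrMr // -!natrM !ler_nat.
  by rewrite mulnC jge mulnC jle.
Qed.

Lemma slope_path_step rho N i k : (0 < N)%N -> 0 <= rho ->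
  `|slope_path rho i (k.+1%:R / N%:R) - slope_path rho i (k%:R / N%:R)|
    <= 2 * rho / N%:R.
Proof.
move=> N0 r0; apply: le_trans (slope_path_lip _ _ _ _ r0) _.
by rewrite -mulrBl -natrB // subSnn mul1r ger0_norm ?invr_ge0.
Qed.

End SlopePath.

(** * Graph-like pieces, the translations and the grid *)

Section Sheets.
Context {R : realType} {d : nat}.
Implicit Types (i k : 'I_d) (K a : R) (g : 'rV[R]_d) (N : nat).

Definition off_axis i g g' : R := \sum_(k | k != i) `|g 0 k - g' 0 k|.

(* S a is a piece of the surface with parameter a that is a Lipschitz graph
   over the hyperplane orthogonal to axis i; m a g is the speed, as a varies,
   of the point of the graph above the projection of g. *)
Definition sheet i K (S : R -> set 'rV[R]_d) := exists m : R -> 'rV[R]_d -> R,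
  [/\ forall a g, S a g -> `|m a g| <= K /\ forall k, `|g 0 k| <= K,
      forall a g a' g', S a g -> S a' g' ->
        `|m a g - m a' g'| <= K * (off_axis i g g' + `|a - a'|) &
      forall a g a' g', S a g -> S a' g' ->
        `|g 0 i - g' 0 i - m a g * (a - a')|
          <= K * (off_axis i g g' + `|a - a'| ^+ 2)].

Lemma off_axis_le i g g' (e : R) : 0 <= e ->
  (forall k, k != i -> `|g 0 k - g' 0 k| <= e) -> off_axis i g g' <= d%:R * e.
Proof.
move=> e0 ge; apply: (@le_trans _ _ (\sum_(k < d) e)); last first.
  by rewrite sumr_const card_ord mulr_natl.
rewrite /off_axis big_mkcond /=; apply: ler_sum => k _.
by case: ifP => // /ge.
Qed.

(** Large enough to contain, for every axis [i < d], the scale found by [slope_path_hit]. *)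
Definition scales N : nat := (N * (4 * d + 7))%N.

Definition kakeya_shift K N a : 'rV[R]_d :=
  \row_k sawsum (fun j => slope_path K k (j%:R / N%:R)) (scales N) (a - 1).

(** This is [sawsum_dyad] with step [c = 2K/N]; its error [2 c 2^-j] becomes [4K 2^-j / N]. *)
Lemma kakeya_shift_dyad K N j a a' k : 0 <= K -> (0 < N)%N ->
  (j <= scales N)%N -> 1 <= a -> 1 <= a' -> dyad j (a - 1) = dyad j (a' - 1) ->
  `|kakeya_shift K N a 0 k - kakeya_shift K N a' 0 k
    - slope_path K k (j%:R / N%:R) * (a - a')| <= 4 * K * (2 ^- j / N%:R).
Proof.
move=> K0 N0 jJ a1 a1' aa'; rewrite !mxE.
have -> : a - a' = (a - 1) - (a' - 1) by ring.
apply: le_trans (sawsum_dyad _ (2 * K / N%:R) _ _ _ _ _ _ jJ _ _ aa') _.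
- by move=> q; exact: slope_path_step.
- by rewrite mul0r slope_path_init.
- by rewrite subr_ge0.
- by rewrite subr_ge0.
- by rewrite le_eqVlt; apply/orP; left; apply/eqP; ring.
Qed.

Lemma kakeya_shift_le K N a k : 0 <= K -> (0 < N)%N -> 1 <= a ->
  `|kakeya_shift K N a 0 k| <= 4 * K.
Proof.
move=> K0 N0 a1; rewrite mxE.
apply: le_trans (sawsum_le _ (2 * K / N%:R) _ _ _ _) _.
- by move=> q; exact: slope_path_step.
- by rewrite subr_ge0.
- rewrite mulrA (_ : 2 * (2 * K) = 4 * K); last by ring.
  by rewrite ler_pdivrMr ?ltr0n // ler_peMr ?mulr_ge0 // ler1n.
Qed.

(** For [|x| < B], the index of [x] among [L] equal half-open intervals that cut up [[-B, B)]. *)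
Definition cell (B : R) (L : nat) (x : R) : nat :=
  Num.truncn ((x + B) * (L%:R / (2 * B))).

Lemma cell_lt (B : R) L x : (0 < L)%N -> `|x| < B -> (cell B L x < L)%N.
Proof.
move=> L0; rewrite ltr_norml => /andP[x1 x2]; have B0 : 0 < 2 * B by lra.
have LR : 0 < L%:R :> R by rewrite ltr0n.
rewrite truncn_lt_nat; last by rewrite mulr_ge0 ?divr_ge0 ?(ltW B0) //; lra.
by rewrite mulrCA -ltr_pdivlMl // mulVf ?gt_eqF // ltr_pdivrMr // mul1r; lra.
Qed.

Lemma cell_dist (B : R) L x y : (0 < L)%N -> `|x| < B -> `|y| < B ->
  cell B L x = cell B L y -> `|x - y| <= 2 * B / L%:R.
Proof.
move=> L0; rewrite !ltr_norml => /andP[x1 x2] /andP[y1 y2].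
have B0 : 0 < 2 * B by lra.
have LR : 0 < L%:R :> R by rewrite ltr0n.
have r0 : 0 < L%:R / (2 * B) by rewrite divr_gt0.
have xr : 0 <= (x + B) * (L%:R / (2 * B)) by rewrite mulr_ge0 ?(ltW r0) //; lra.
have yr : 0 <= (y + B) * (L%:R / (2 * B)) by rewrite mulr_ge0 ?(ltW r0) //; lra.
move: (truncn_itv xr) (truncn_itv yr); rewrite /cell => + + xy; rewrite xy.
set q := Num.truncn _; rewrite -natr1 => xq yq.
rewrite -invf_div -[leRHS]div1r ler_pdivlMr //.
rewrite -[X in _ * X]ger0_norm ?(ltW r0) //.
by rewrite -normrM ler_norml; lra.
Qed.

End Sheets.

(** * Covering all translates of one sheet *)

Section SheetCover.
Context {R : realType} {d : nat} (i : 'I_d) (K c0 : R).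
Hypotheses (K0 : 0 < K) (c00 : 0 <= c0).
Context (S : R -> set 'rV[R]_d) (m : R -> 'rV[R]_d -> R).
Hypothesis (mK : forall a g, S a g -> `|m a g| <= K /\ forall k, `|g 0 k| <= K).
Hypothesis (m_lip : forall a g a' g', S a g -> S a' g' ->
  `|m a g - m a' g'| <= K * (off_axis i g g' + `|a - a'|)).
Hypothesis (m_lin : forall a g a' g', S a g -> S a' g' ->
  `|g 0 i - g' 0 i - m a g * (a - a')|
    <= K * (off_axis i g g' + `|a - a'| ^+ 2)).
Context (N : nat) (h : R) (N0 : (0 < N)%N).

Let T : Type := (R * 'rV[R]_d * 'rV[R]_d)%type.
Let J := @scales d N.
Let small j : R := 2 ^- j / N%:R.
Hypothesis hJ : h <= c0 * small J.

(* (a, g, y) encodes the point t(a) + g + y near the translated copy of S a. *)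
Definition data : set T := [set z : T | [/\ 1 <= z.1.1 <= 2, S z.1.1 z.1.2 &
  forall k, `|z.2 0 k| <= h]].

Definition data_point (z : T) : 'rV[R]_d :=
  kakeya_shift K N z.1.1 + z.1.2 + z.2.

Lemma data_pointE z k :
  data_point z 0 k = kakeya_shift K N z.1.1 0 k + z.1.2 0 k + z.2 0 k.
Proof. by rewrite [LHS]mxE [X in X + _]mxE. Qed.

(** Error budgets in units of [small j]. Off the axis: 1 for the grid width, [2 c0] for the two
    perturbations, [4K] for the translations. Along the axis: [4K] for the translations, [2K] for
    the slope mismatch, [K (d off_const + 1)] once for the variation of [m] and once for its
    linearization error, and [2 c0]. *)
Definition off_const := 1 + 2 * c0 + 4 * K.
Definition axis_const := 6 * K + 2 * (K * (d%:R * off_const + 1)) + 2 * c0.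
(** The sum of the bounds on translation, surface and perturbation; the final 1 makes the bound
    strict, as [cell_lt] requires. *)
Definition range_const := 5 * K + c0 + 1.
Definition sheet_const :=
  2 * (2 ^+ d * ((2 * range_const) ^+ d.-1 * axis_const)).

Lemma small_ge0 j : 0 <= small j.
Proof. by rewrite /small divr_ge0 ?invr_ge0 ?exprn_ge0. Qed.

Lemma off_const_ge0 : 0 <= off_const.
Proof. by rewrite /off_const; move: K0 c00; lra. Qed.

Lemma axis_const_ge0 : 0 <= axis_const.
Proof.
have := mulr_ge0 (ltW K0) (addr_ge0 (mulr_ge0 (ler0n R d) off_const_ge0) ler01).
by rewrite /axis_const; move: K0 c00; lra.
Qed.

Lemma range_const_gt0 : 0 < range_const.
Proof. by rewrite /range_const; move: K0 c00; lra. Qed.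

Lemma small_le j j' : (j <= j')%N -> small j' <= small j.
Proof.
move=> jj; rewrite /small ler_wpM2r ?invr_ge0 // lef_pV2 ?posrE ?exprn_gt0 //.
by rewrite ler_eXn2l // ltr1n.
Qed.

Lemma small_J_le1 : small J <= 1.
Proof.
apply: le_trans (small_le 0 J (leq0n _)) _.
by rewrite /small expr0 invr1 mul1r invf_le1 ?ltr0n // ler1n.
Qed.

Lemma exp2N_le : 2 ^- N <= N%:R^-1 :> R.
Proof.
rewrite lef_pV2 ?posrE ?exprn_gt0 ?ltr0n // -natrX ler_nat.
exact/ltnW/ltn_expl.
Qed.

Lemma data_point_lt z k : data z -> `|data_point z 0 k| < range_const.
Proof.
move=> [/andP[a1 _] /mK[_ /(_ k) gk] /(_ k) yk]; rewrite data_pointE.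
apply: le_lt_trans (ler_normD _ _) _.
apply: (@le_lt_trans _ _ (4 * K + K + c0)); last by rewrite /range_const; lra.
apply: lerD; last first.
  by apply: le_trans yk (le_trans hJ _); rewrite ler_piMr // small_J_le1.
apply: le_trans (ler_normD _ _) _; apply: lerD => //.
exact: kakeya_shift_le (ltW K0) N0 a1.
Qed.

Section Pair.
Context (j : nat) (z z' : T) (eta : R).
Hypotheses (Dz : data z) (Dz' : data z') (jJ : (j <= J)%N).
Hypothesis (dy : dyad j (z.1.1 - 1) = dyad j (z'.1.1 - 1)).
Hypothesis (etaJ : eta <= small J).
Hypothesis (close : forall k, k != i ->
  `|data_point z 0 k - data_point z' 0 k| <= eta).
Hypothesis (still : forall k, k != i -> slope_path K k (j%:R / N%:R) = 0).

(** Off the axis the slopes at scale [j] vanish, so the two translations differ by [O(small j)]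
    there, and closeness of the data points passes to the surface points. *)
Lemma pair_off : off_axis i z.1.2 z'.1.2 <= d%:R * (off_const * small j).
Proof.
have [/andP[a1 _] _ yh] := Dz; have [/andP[a1' _] _ yh'] := Dz'.
apply: off_axis_le => [|k ki].
  by rewrite mulr_ge0 ?off_const_ge0 ?small_ge0.
have := kakeya_shift_dyad K N j z.1.1 z'.1.1 k (ltW K0) N0 jJ a1 a1' dy.
rewrite (still k ki) mul0r subr0 -/(small j) => ts.
have := close k ki; have := yh k; have := yh' k.
have hs : h <= c0 * small j.
  by apply: le_trans hJ _; rewrite ler_wpM2l // small_le.
have es : eta <= small j by apply: le_trans etaJ _; rewrite small_le.
rewrite !data_pointE.
rewrite /off_const; move: (small j) ts hs es => s.
by rewrite !ler_norml; lra.
Qed.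

Lemma pair_a : `|z.1.1 - z'.1.1| <= 2 ^- j.
Proof.
have [/andP[a1 _] _ _] := Dz; have [/andP[a1' _] _ _] := Dz'.
have -> : z.1.1 - z'.1.1 = (z.1.1 - 1) - (z'.1.1 - 1) by ring.
by apply: dyad_dist => //; rewrite subr_ge0.
Qed.

(** The translation contributes [v da] and the surface [m da]; since [v + m = O(1/N)] and
    [|da| <= 2^-j], their sum is [O(small j)]. *)
Lemma pair_axis (m0 : R) : (N <= j)%N ->
  `|slope_path K i (j%:R / N%:R) + m0| <= 2 * K / N%:R ->
  `|m z.1.1 z.1.2 - m0| <= K * (d%:R * off_const + 1) / N%:R ->
  `|data_point z 0 i - data_point z' 0 i| <= axis_const * small j.
Proof.
move=> Nj vm0 mm0.
have [/andP[a1 _] Sz yh] := Dz; have [/andP[a1' _] Sz' yh'] := Dz'.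
have := kakeya_shift_dyad K N j z.1.1 z'.1.1 i (ltW K0) N0 jJ a1 a1' dy.
rewrite -/(small j); set v := slope_path _ _ _ in vm0 * => ts.
have hs : h <= c0 * small j.
  by apply: le_trans hJ _; rewrite ler_wpM2l // small_le.
have yi := yh i; have yi' := yh' i.
(* Here [N <= j] enters: one factor [2^-j] is at most [2^-N], hence at most [1/N]. *)
have A2 : `|z.1.1 - z'.1.1| ^+ 2 <= small j.
  rewrite expr2 /small ler_pM ?pair_a //; apply: le_trans pair_a _.
  apply: le_trans exp2N_le.
  by rewrite lef_pV2 ?posrE ?exprn_gt0 // ler_eXn2l // ltr1n.
have lin : `|z.1.2 0 i - z'.1.2 0 i - m z.1.1 z.1.2 * (z.1.1 - z'.1.1)|
    <= K * (d%:R * off_const + 1) * small j.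
  apply: le_trans (m_lin _ _ _ _ Sz Sz') _; rewrite -mulrA ler_pM2l //.
  by rewrite mulrDl mul1r lerD // -mulrA pair_off.
have vm : `|(v + m z.1.1 z.1.2) * (z.1.1 - z'.1.1)|
    <= (2 * K + K * (d%:R * off_const + 1)) * small j.
  rewrite normrM /small [2 ^- j / _]mulrC mulrA.
  apply: ler_pM; rewrite ?pair_a //.
  rewrite mulrDl; apply: le_trans (lerD vm0 mm0).
  by apply: le_trans (ler_normD _ _); rewrite le_eqVlt; apply/orP; left;
    apply/eqP; congr `| _ |; ring.
rewrite !data_pointE.
rewrite /axis_const; move: (K * _) (small j) vm lin ts hs => Q s.
by move: yi yi'; rewrite !ler_norml; lra.
Qed.

End Pair.

(** Data are sorted by the interval of length [2^-N] containing [a - 1] and by the grid cell of the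
    off-axis coordinates. Within a class [m] varies by [O(1/N)], so a single scale [j] suits it; its
    [2^(j-N)] subintervals have axis extents adding up to [O(small N)], whatever [j] is. Summing
    over [2^N + 1] intervals leaves [O(1/N)]. *)
Lemma data_coverable : box_coverable (data_point @` data) (sheet_const / N%:R).
Proof.
pose B := range_const; have B0 : 0 < B := range_const_gt0.
have NR : 0 < N%:R :> R by rewrite ltr0n.
have sJ0 : 0 < small J by rewrite divr_gt0 ?invr_gt0 ?exprn_gt0.
(* This many cells make the grid width [eta] at most [small J], hence at most [small j] for every
   scale in use. *)
pose L := (Num.truncn (2 * B / small J)).+1.
have LR : 0 < L%:R :> R by rewrite ltr0n.
pose eta := 2 * B / L%:R.
have eta0 : 0 <= eta by rewrite divr_ge0 ?mulr_ge0 // ltW.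
have etaJ : eta <= small J.
  rewrite ler_pdivrMr // [leRHS]mulrC -ler_pdivrMr //.
  exact/ltW/truncnS_gt.
pose cost := 2 ^+ d * (eta ^+ d.-1 * (axis_const * small N)).
have eta_axis_ge0 : 0 <= eta ^+ d.-1 * axis_const.
  by rewrite mulr_ge0 ?exprn_ge0 ?axis_const_ge0.
pose I := {ffun {k : 'I_d | k != i} -> 'I_L}.
pose in_cell (z : T) (c : I) :=
  forall k, cell B L (data_point z 0 (val k)) = c k :> nat.
have cov_cell (w : 'I_(2 ^ N).+1) (c : I) : box_coverable (data_point @`
    [set z | (data z /\ dyad N (z.1.1 - 1) = w) /\ in_cell z c]) cost.
  have [[z0 [[Dz0 z0w] z0c]]|nz] :=
      pselect (exists z, (data z /\ dyad N (z.1.1 - 1) = w) /\ in_cell z c);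
      last first.
    apply: box_coverable_le box_coverable0.
      by move=> x [z hz]; case: nz; exists z.
    by rewrite mulr_ge0 ?exprn_ge0 // mulrA mulr_ge0 ?small_ge0.
  have [_ Sz0 _] := Dz0; have [m0K _] := mK _ _ Sz0.
  (* The scale is chosen for an arbitrary member [z0] of the class. *)
  have [j [Nj jle hit still]] := slope_path_hit K N i _ N0 K0 m0K.
  have jJ : (j <= J)%N.
    apply: leq_trans jle _.
    by rewrite /J /scales leq_mul2l leq_add2r leq_mul2l ltnW ?ltn_ord ?orbT.
  have close z z' : data z -> data z' -> in_cell z c -> in_cell z' c ->
      forall k, k != i -> `|data_point z 0 k - data_point z' 0 k| <= eta.
    move=> Dz Dz' zc z'c k ki; apply: cell_dist => //.
    - exact: data_point_lt.
    - exact: data_point_lt.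
    - by have := zc (exist _ k ki); have := z'c (exist _ k ki) => /= -> ->.
  have m_near z : data z -> dyad N (z.1.1 - 1) = w -> in_cell z c ->
      `|m z.1.1 z.1.2 - m z0.1.1 z0.1.2|
        <= K * (d%:R * off_const + 1) / N%:R.
    move=> Dz zw zc; have [_ Sz _] := Dz.
    apply: le_trans (m_lip _ _ _ _ Sz Sz0) _; rewrite -mulrA ler_pM2l //.
    have zz0 : dyad N (z.1.1 - 1) = dyad N (z0.1.1 - 1) by rewrite zw z0w.
    have NJ : (N <= J)%N := leq_trans Nj jJ.
    rewrite mulrDl mul1r; apply: lerD; last first.
      exact: le_trans (pair_a _ _ _ Dz Dz0 zz0) exp2N_le.
    (* At scale [N] the path is at time 1, where all slopes are still 0, so [pair_off] applies
       without any matching of slopes. *)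
    apply: le_trans (pair_off N z z0 eta Dz Dz0 NJ zz0 etaJ _ _) _.
    - exact: close.
    - by move=> k _; rewrite divff ?gt_eqF // slope_path_init // ler1n.
    - rewrite mulrA ler_wpM2l ?mulr_ge0 ?off_const_ge0 //.
      rewrite /small ler_piMl ?invr_ge0 //.
      by rewrite invf_le1 ?exprn_gt0 // exprn_ege1 // ler1n.
  (* Each interval of scale [N] holds [Q] intervals of scale [j]; with the quotient fixed to [w],
     the residue mod [Q] identifies one. *)
  pose Q := (2 ^ (j - N))%N; have Q0 : (0 < Q)%N by rewrite expn_gt0.
  apply: box_coverable_le (@subset_refl _ _) _
    (box_coverable_fibers 'I_Q _ _ (fun z r => dyad j (z.1.1 - 1) %% Q = r)%N
      (2 ^+ d * (eta ^+ d.-1 * (axis_const * small j))) _ _).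
  - rewrite card_ord /cost.
    suff -> : small N = Q%:R * small j by lra.
    rewrite /small /Q natrX mulrA; congr (_ / _).
    by rewrite -[in 2 ^- j](subnK Nj) exprD invfM mulrA divff ?mul1r //
      expf_neq0.
  - by move=> z _; exists (Ordinal (ltn_pmod (dyad j (z.1.1 - 1)) Q0)).
  - move=> r; apply: (box_coverable_diam _ i) => //.
    + by rewrite mulr_ge0 ?axis_const_ge0 ?small_ge0.
    + move=> _ _ [z [[[Dz zw] zc] zr] <-] [z' [[[Dz' z'w] z'c] z'r] <-].
      exact: close.
    + move=> _ _ [z [[[Dz zw] zc] zr] <-] [z' [[[Dz' z'w] z'c] z'r] <-].
      have [/andP[a1 _] _ _] := Dz; have [/andP[a1' _] _ _] := Dz'.
      have dy : dyad j (z.1.1 - 1) = dyad j (z'.1.1 - 1).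
        rewrite (divn_eq (dyad j (z.1.1 - 1)) Q).
        rewrite (divn_eq (dyad j (z'.1.1 - 1)) Q).
        by rewrite -!dyad_div ?subr_ge0 // zr z'r zw z'w.
      apply: (pair_axis j z z' eta Dz Dz' jJ dy etaJ _ _
        (m z0.1.1 z0.1.2)) => //.
      * exact: close.
      * by move=> k ki; apply: still.
      * exact: m_near.
apply: box_coverable_le (@subset_refl _ _) _
  (box_coverable_fibers 'I_(2 ^ N).+1 _ _ (fun z w => dyad N (z.1.1 - 1) = w)
    (#|I|%:R * cost) _ _).
- rewrite card_ord card_ffun card_ord card_sig (eq_card (B := predC1 i)) //.
  rewrite cardC1 card_ord /cost /sheet_const -/B.
  (* The number of cells cancels the smallness of [eta], whatever [L] is. *)
  have -> : (2 * B) ^+ d.-1 = (L ^ d.-1)%:R * eta ^+ d.-1.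
    by rewrite natrX -exprMn /eta [L%:R * _]mulrC divfK // gt_eqF.
  have N2 : (2 ^ N).+1%:R * 2 ^- N <= 2 :> R.
    rewrite ler_pdivrMr ?exprn_gt0 // -natrX -natrM ler_nat.
    by rewrite mul2n -addnn -addn1 leq_add2l expn_gt0.
  rewrite -subr_ge0.
  set e := eta ^+ _; set l := (L ^ _)%:R; set t := (2 ^ N).+1%:R in N2 *.
  rewrite /small.
  have -> : 2 * (2 ^+ d * (l * e * axis_const)) / N%:R -
      t * (l * (2 ^+ d * (e * (axis_const * (2 ^- N / N%:R))))) =
      (2 - t * 2 ^- N) * (2 ^+ d * (l * (e * axis_const)) / N%:R) by ring.
  by rewrite mulr_ge0 ?subr_ge0 // divr_ge0 // mulr_ge0 ?exprn_ge0 // mulr_ge0.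
(* The endpoint [a = 2] has index [2 ^ N], hence one label more than [2 ^ N]. *)
- move=> z [/andP[a1 a2] _ _].
  suff w : (dyad N (z.1.1 - 1) < (2 ^ N).+1)%N by exists (Ordinal w).
  rewrite ltnS truncn_le_nat -[(2 ^ N).+1%:R]natr1 natrX.
  apply: le_lt_trans (_ : _ <= 2 ^+ N) _; rewrite ?ltrDl //.
  by rewrite ler_piMr ?exprn_ge0 //; lra.
- move=> w.
  apply: (box_coverable_fibers I _ _ in_cell) => [z [Dz _]|c];
    last exact: cov_cell.
  have lt (k : {k : 'I_d | k != i}) :
    (cell B L (data_point z 0%R (val k)) < L)%N by apply/cell_lt/data_point_lt.
  by exists [ffun k => Ordinal (lt k)] => k; rewrite ffunE.
Qed.

End SheetCover.

(** * From sheets to a compact set with small neighbourhood *)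

Section Sweep.
Context {R : realType} {d : nat}.
Implicit Types (K delta : R) (N : nat).

Lemma coord_le_enorm (y : 'rV[R]_d) k : `|y 0 k| <= enorm y.
Proof.
rewrite -sqrtr_sqr ler_wsqrtr // (bigD1 k) //= lerDl.
by apply: sumr_ge0 => l _; rewrite sqr_ge0.
Qed.

Lemma compact_closure_bounded (U : set 'rV[R]_d) (B : R) :
  (forall u, U u -> forall k, `|u 0 k| <= B) -> compact (closure U).
Proof.
move=> UB; pose Q : set 'rV[R]_d :=
  [set v | forall k, `[- B, B]%classic (v ord0 k)].
have cQ : compact Q.
  exact: (@rV_compact R d (fun=> `[- B, B]%classic)
    (fun=> @segment_compact _ _ _)).
apply: (@subclosed_compact _ _ Q) => //; first exact: closed_closure.
have UQ : U `<=` Q by move=> u Uu k /=; rewrite in_itv /= -ler_norml UB.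
move=> x /(closureS UQ); apply: compact_closed => //; exact: norm_hausdorff.
Qed.

(** A point of the closure is within [delta] of [U] in the sup norm, so passing to the closure only
    doubles the radius. *)
Lemma neighbourhood_closure (U : set 'rV[R]_d) delta : 0 < delta ->
  neighbourhood (closure U) delta `<=`
    [set u + y | u in U &
      y in [set y : 'rV[R]_d | forall k, `|y 0 k| <= 2 * delta]].
Proof.
move=> d0 _ [x Ux [y /= ydelta <-]].
have [u [Uu [_ /(_ 0) xu]]] := Ux _ (nbhsx_ballx x delta d0).
exists u => //; exists (x - u + y); last by rewrite addrA addrCA subrr addr0.
move=> k; rewrite !mxE; apply: le_trans (ler_normD _ _) _.
rewrite (_ : 2 * delta = delta + delta); last by ring.
apply: lerD; first by rewrite ltW //; exact: xu.
by apply: le_trans (coord_le_enorm y k) (ltW _).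
Qed.

Lemma scales_count M : (M.+2 + @scales d M.+1 = 4 * d + 9 + (4 * d + 8) * M)%N.
Proof. by rewrite /scales; ring. Qed.

(** Take [N = M + 1] with [M] the integer part of [|ln delta| / (4d+8)]. As [2 <= e],
    [delta 2^((4d+8)M) <= 1]; of the factor [4d+8], the part [4d+7] pays for the scales and 1 for
    [N <= 2^N]. *)
Lemma scales_choice delta : 0 < delta < 1 / 2 ->
  exists2 N, (0 < N)%N & 
    N%:R^-1 <= (4 * d + 8)%:R * `|ln delta|^-1 /\
    2 * delta <= 2 ^+ (4 * d + 9) * (2 ^- (@scales d N) / N%:R).
Proof.
move=> /andP[d0 d2]; set c := (4 * d + 8)%N.
have c0 : 0 < c%:R :> R by rewrite ltr0n /c addnC.
have ln0 : ln delta < 0 by apply: ln_lt0; rewrite d0 /=; lra.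
rewrite ltr0_norm //; set l := - ln delta; have l0 : 0 < l by rewrite oppr_gt0.
have /andP[Nl Nu] := truncn_itv (ltW (divr_gt0 l0 c0)).
set M := Num.truncn _ in Nl Nu; exists M.+1 => //; split.
  rewrite -[leRHS]invf_div lef_pV2 ?posrE ?ltr0n ?divr_gt0 //.
  exact: ltW.
have dM : delta * 2 ^+ (c * M) <= 1.
  rewrite -[delta]lnK ?posrE // -[X in expR X]opprK -/l expRN mulrC.
  rewrite ler_pdivrMr ?expR_gt0 // mul1r.
  apply: (@le_trans _ _ (expR 1 ^+ (c * M))).
    rewrite lerXn2r ?nnegrE ?expR_ge0 //.
    by have := expR_ge1Dx (1 : R); rewrite -[1 + 1]/(2).
  rewrite -expRM_natl mulr1 ler_expR natrM mulrC.
  by rewrite -ler_pdivlMr.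
have pos k : 0 < 2 ^+ k :> R by rewrite exprn_gt0.
rewrite mulrA ler_pdivlMr ?ltr0n // ler_pdivlMr //.
have Mexp : M.+1%:R <= 2 ^+ M.+1 :> R.
  by rewrite -natrX ler_nat ltnW // ltn_expl.
apply: (@le_trans _ _ (2 * delta * 2 ^+ M.+1 * 2 ^+ @scales d M.+1)).
  by rewrite ler_wpM2r ?(ltW (pos _)) // ler_wpM2l // mulr_ge0 // ltW.
have -> : 2 * delta * 2 ^+ M.+1 * 2 ^+ @scales d M.+1 =
    2 ^+ (4 * d + 9) * (delta * 2 ^+ (c * M)).
  have E : 2 * 2 ^+ M.+1 * 2 ^+ @scales d M.+1 =
      2 ^+ (4 * d + 9) * 2 ^+ (c * M) :> R.
    by rewrite -exprS -!exprD; congr (2 ^+ _); exact: scales_count.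
  by rewrite [RHS]mulrCA -E !mulrA [delta * 2]mulrC.
by rewrite ler_piMr // ltW.
Qed.

Definition thin_sweep (Gamma : R -> set 'rV[R]_d) (c delta : R) :=
  exists E : set 'rV[R]_d,
    [/\ compact E,
        forall a : R, 1 <= a <= 2 ->
          exists t : 'rV[R]_d, [set t + x | x in Gamma a] `<=` E
      & (lebesgue_rV (neighbourhood E delta) <= c%:E)%E].

Theorem sweep K (I : finType) (dir : I -> 'I_d) (S : I -> R -> set 'rV[R]_d)
    (Gamma : R -> set 'rV[R]_d) : (0 < d)%N -> 0 < K ->
  (forall t, sheet (dir t) K (S t)) ->
  (forall a, 1 <= a <= 2 -> forall g, Gamma a g -> exists t, S t a g) ->
  exists2 C : R, 0 <= C & forall delta, 0 < delta < 1 / 2 ->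
  thin_sweep Gamma (C * `|ln delta|^-1) delta.
Proof.
move=> dgt0 K0 Ssheet GS; pose c0 : R := 2 ^+ (4 * d + 9).
have c00 : 0 <= c0 by rewrite exprn_ge0.
have sc0 : 0 <= @sheet_const R d K c0.
  rewrite !mulr_ge0 ?exprn_ge0 ?mulr_ge0 ?axis_const_ge0 //.
  exact/ltW/range_const_gt0.
exists (#|I|%:R * sheet_const (d := d) K c0 * (4 * d + 8)%:R).
  by rewrite mulr_ge0 // mulr_ge0.
move=> delta delta12; have [N N0 [Nln dN]] := scales_choice delta delta12.
have [d0 _] := andP delta12.
pose U : set 'rV[R]_d :=
  [set p | exists a g,
    [/\ 1 <= a <= 2, Gamma a g & p = kakeya_shift K N a + g]].
(* The translation jumps as [a] varies, so the union [U] need not be closed. *)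
exists (closure U); split.
- apply: (compact_closure_bounded _ (5 * K)) => _ [a [g [a12 Gg ->]]] k.
  have [t Stg] := GS a a12 g Gg.
  have [m [/(_ _ _ Stg)[_ /(_ k) gK] _ _]] := Ssheet t.
  rewrite mxE (_ : 5 * K = 4 * K + K); last by ring.
  apply: le_trans (ler_normD _ _) (lerD _ gK).
  by case/andP: a12 => a1 _; apply: kakeya_shift_le => //; exact: ltW.
- move=> a a12; exists (kakeya_shift K N a) => _ [g Gg <-].
  by apply: subset_closure; exists a, g.
- apply: lebesgue_rV_coverable => //.
  pose D : set (R * 'rV[R]_d * 'rV[R]_d) := [set z : R * 'rV[R]_d * 'rV[R]_d |
    [/\ 1 <= z.1.1 <= 2, Gamma z.1.1 z.1.2 &
      forall k, `|z.2 0 k| <= 2 * delta]].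
  apply: box_coverable_le (_ : _ `<=` data_point K N @` D) _
    (box_coverable_fibers I _ _ (fun z t => S t z.1.1 z.1.2)
      (sheet_const (d := d) K c0 / N%:R) _ _).
  + move=> p /neighbourhood_closure -/(_ d0) [_ [a [g [a12 Gg ->]]] [y yd <-]].
    by exists (a, g, y).
  + by rewrite mulrA -[leRHS]mulrA ler_wpM2l // mulr_ge0.
  + by move=> z [a12 Gg _]; exact: GS.
  + move=> t; have [m [mK m_lip m_lin]] := Ssheet t.
    apply: box_coverable_le (lexx _) (data_coverable (dir t) K c0 K0 c00 (S t) m
      mK m_lip m_lin N (2 * delta) N0 dN).
    by move=> _ [z [[a12 _ yd] Sz] <-]; exists z.
Qed.

End Sweep.

(** * Sheets of the three families *)

Section Families.
Context {R : realType}.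

Lemma enorm_sqr n (x : 'rV[R]_n) : enorm x ^+ 2 = \sum_(k < n) x 0 k ^+ 2.
Proof. by rewrite sqr_sqrtr // sumr_ge0 // => k _; rewrite sqr_ge0. Qed.

Lemma enorm_ge0 n (x : 'rV[R]_n) : 0 <= enorm x.
Proof. exact: sqrtr_ge0. Qed.

(** Squares are compared term by term, using [|v_k| <= enorm v] and [|u_k - v_k| <= D]. *)
Lemma enorm_dist n (x y : 'rV[R]_n) :
  `|enorm x - enorm y| <= \sum_(k < n) `|x 0 k - y 0 k|.
Proof.
have tri (u v : 'rV[R]_n) : enorm u <= enorm v + \sum_(k < n) `|u 0 k - v 0 k|.
  set D := \sum_(k < n) _; have D0 : 0 <= D by exact: sumr_ge0.
  have hD k : `|u 0 k - v 0 k| <= D.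
    by rewrite /D (bigD1 k) //= lerDl sumr_ge0.
  rewrite -(ler_pXn2r (n := 2)) ?nnegrE ?addr_ge0 ?enorm_ge0 //.
  rewrite sqrrD !enorm_sqr.
  have -> : \sum_(k < n) u 0 k ^+ 2 = \sum_(k < n) v 0 k ^+ 2 +
      \sum_(k < n) (v 0 k *+ 2 + (u 0 k - v 0 k)) * (u 0 k - v 0 k).
    by rewrite -big_split; apply: eq_bigr => k _ /=; ring.
  rewrite -addrA lerD2l -mulrnAl expr2 -mulrDl {2}/D mulr_sumr.
  apply: ler_sum => k _; apply: le_trans (ler_norm _) _.
  rewrite normrM ler_wpM2r //; apply: le_trans (ler_normD _ _) _.
  by apply: lerD => //; rewrite normrMn lerMn2r coord_le_enorm orbT.
have := tri x y; have := tri y x; rewrite ler_norml.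
under [in X in X -> _]eq_bigr do rewrite distrC.
by move=> *; lra.
Qed.

(** Bounds a quotient after clearing a denominator [w] with [|w| >= 1/D]. *)
Lemma norm_div_bound (x w D b : R) : 1 <= D * `|w| -> 0 <= D ->
  `|x * w| <= b -> `|x| <= D * b.
Proof.
move=> Dw D0 xb; apply: le_trans (ler_wpM2l D0 xb).
by rewrite normrM mulrCA ler_peMr.
Qed.

(** The height [a phi(X)] is linear in [a], with speed [phi(X)]. The linearization error is exactly
    [a' (phi X - phi X')], and [a' <= 2] with Lipschitz constant 2 gives 4. *)
Lemma graph_sheet n (phi : 'rV[R]_n -> R) :
  (forall X, enorm X <= 1 -> 0 <= phi X <= 1) ->
  (forall X X', enorm X <= 1 -> enorm X' <= 1 ->
    `|phi X - phi X'| <= 2 * `|enorm X - enorm X'|) ->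
  sheet (rshift n ord0) 4 (fun a => [set g | 1 <= a <= 2 /\
    (ypart g = a * phi (Xpart g) /\ enorm (Xpart g) <= 1)]).
Proof.
move=> phi01 phi_lip.
have off (g g' : 'rV[R]_(n + 1)) : `|enorm (Xpart g) - enorm (Xpart g')|
    <= off_axis (rshift n ord0) g g'.
  apply: le_trans (enorm_dist _ _ _) _.
  rewrite /off_axis big_split_ord /= [X in _ + X]big1 ?addr0; last first.
    by move=> k; rewrite ord1 eqxx.
  rewrite [leRHS]big_mkcond /=; apply: ler_sum => k _.
  by rewrite (_ : lshift 1 k != rshift n ord0) ?mxE // eq_lrshift.
exists (fun _ g => phi (Xpart g)); split.
- move=> a g [a12 [yg Xg]]; have /andP[p0 p1] := phi01 _ Xg.
  split=> [|k]; first by rewrite ger0_norm //; lra.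
  case: (split_ordP k) => l ->.
    have := coord_le_enorm (Xpart g) l; rewrite mxE => h.
    by apply: le_trans h (le_trans Xg _); rewrite ler1n.
  have -> : g 0 (rshift n l) = ypart g by rewrite /ypart mxE ord1.
  by rewrite yg ger0_norm ?mulr_ge0 //; [nra|lra].
- move=> a g a' g' [a12 [yg Xg]] [a12' [yg' Xg']].
  apply: le_trans (phi_lip _ _ Xg Xg') _.
  have := off g g'; have := normr_ge0 (a - a').
  by have := normr_ge0 (enorm (Xpart g) - enorm (Xpart g')); lra.
- move=> a g a' g' [a12 [yg Xg]] [a12' [yg' Xg']].
  have yE (x : 'rV[R]_(n + 1)) : x 0 (rshift n ord0) = ypart x.
    by rewrite /ypart mxE.
  rewrite !yE yg yg'.
  have -> : a * phi (Xpart g) - a' * phi (Xpart g') - phi (Xpart g) * (a - a')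
    = a' * (phi (Xpart g) - phi (Xpart g')) by ring.
  rewrite normrM ger0_norm; last by lra.
  have := phi_lip _ _ Xg Xg'; have := off g g'; have := sqr_ge0 `|a - a'|.
  have := normr_ge0 (phi (Xpart g) - phi (Xpart g')).
  have := normr_ge0 (enorm (Xpart g) - enorm (Xpart g')).
  by move=> ? ? ? ? ?; nra.
Qed.

Definition sphere_sheet d (t : 'I_d * bool) (a : R) : set 'rV[R]_d :=
  [set g | [/\ 1 <= a <= 2, \sum_(k < d) g 0 k ^+ 2 = a ^+ 2 &
    1 <= (2 * d)%:R * ((-1) ^+ t.2 * g 0 t.1)]].

(** If every coordinate were below [1/(2d)] in modulus, the sum of squares would be at most 1/4,
    while [a ^+ 2 >= 1]. *)
Lemma sphere_sheet_cover d a (g : 'rV[R]_d) : 1 <= a <= 2 ->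
  \sum_(k < d) g 0 k ^+ 2 = a ^+ 2 -> exists t, sphere_sheet d t a g.
Proof.
move=> a12 ga; apply: contrapT => nt.
have small k : (2 * d)%:R * `|g 0 k| < 1.
  rewrite ltNge; apply/negP => gk; apply: nt.
  exists (k, g 0 k < 0); split => //=.
  by rewrite -normrEsign.
have d0 : 0 < d%:R :> R.
  rewrite ltr0n lt0n; apply/eqP => d0; move: ga; rewrite big1; first by nra.
  by move=> k; have := ltn_ord k; rewrite [X in (_ < X)%N]d0.
have : \sum_(k < d) g 0 k ^+ 2 <= \sum_(k < d) d%:R^-1 / 4.
  apply: ler_sum => k _; rewrite ler_pdivlMr // -[leRHS]mul1r ler_pdivlMr //.
  have := small k; rewrite natrM -real_normK ?num_real //.
  have d1 : 1 <= d%:R :> R by rewrite ler1n -(ltr0n R).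
  by have := normr_ge0 (g 0 k); nra.
rewrite sumr_const card_ord ga -mulrnAl -mulr_natr mulVf ?gt_eqF //.
by nra.
Qed.

(** Differentiating the equation of the sphere gives the speed [a / g_i]. Denominators [g_i] and
    [g_i + g'_i] are at least [1/D] in modulus, the latter because both terms have the same sign on
    a sheet. *)
Lemma sphere_sheetP d (t : 'I_d * bool) :
  sheet t.1 (18 * (2 * d)%:R ^+ 3) (sphere_sheet d t).
Proof.
case: t => i s /=; set D : R := (2 * d)%:R.
have D1 : 1 <= D by rewrite ler1n muln_gt0 /=; case: (d) i => [[]|].
have D0 : 0 <= D by apply: le_trans D1.
have sg1 : `|(-1) ^+ s : R| = 1 by rewrite normrX normrN1 expr1n.
have coord a g k : sphere_sheet d (i, s) a g -> `|g 0 k| <= 2.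
  move=> [a12 ga _]; have : g 0 k ^+ 2 <= a ^+ 2.
    by rewrite -ga (bigD1 k) //= lerDl sumr_ge0 // => l _; rewrite sqr_ge0.
  by rewrite ler_norml; nra.
have axis1 a g : sphere_sheet d (i, s) a g -> 1 <= D * `|g 0 i|.
  move=> [_ _ /le_trans]; apply; rewrite ler_wpM2l //.
  by rewrite (le_trans (ler_norm _)) // normrM sg1 mul1r.
have axis_neq0 a g : sphere_sheet d (i, s) a g -> g 0 i != 0.
  by move/axis1; apply: contraTneq => ->; rewrite normr0 mulr0 ler10.
have axis2 a g a' g' : sphere_sheet d (i, s) a g ->
    sphere_sheet d (i, s) a' g' -> 1 <= D * `|g 0 i + g' 0 i|.
  move=> [_ _ h1] [_ _ h2]; move: h1 h2 => /= h1 h2.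
  have : D * ((-1) ^+ s * (g 0 i + g' 0 i)) <= D * `|g 0 i + g' 0 i|.
    by rewrite ler_wpM2l // (le_trans (ler_norm _)) // normrM sg1 mul1r.
  by rewrite mulrDr mulrDr -/D in h1 h2 *; lra.
have diff a g a' g' : sphere_sheet d (i, s) a g ->
    sphere_sheet d (i, s) a' g' ->
    exists2 Q, `|Q| <= 4 * off_axis i g g' &
    (g 0 i - g' 0 i) * (g 0 i + g' 0 i) = (a - a') * (a + a') - Q.
  move=> Sg Sg'; have [_ ga _] := Sg; have [_ ga' _] := Sg'.
  exists (\sum_(k | k != i) (g 0 k ^+ 2 - g' 0 k ^+ 2)).
    apply: le_trans (ler_norm_sum _ _ _) _; rewrite mulr_sumr.
    apply: ler_sum => k _; rewrite subr_sqr normrM mulrC ler_wpM2r //.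
    apply: le_trans (ler_normD _ _) _.
    by have := coord _ _ k Sg; have := coord _ _ k Sg'; lra.
  rewrite (bigD1 i) //= in ga; rewrite (bigD1 i) //= in ga'.
  by rewrite sumrB -!subr_sqr -ga -ga'; ring.
have D2 : 0 <= D ^+ 2 by rewrite exprn_ge0.
have off0 (g g' : 'rV[R]_d) : 0 <= off_axis i g g' by apply: sumr_ge0.
have cross a g a' g' : sphere_sheet d (i, s) a g ->
    sphere_sheet d (i, s) a' g' ->
    `|a * g' 0 i - a' * g 0 i| <= 10 * D * (off_axis i g g' + `|a - a'|).
  move=> Sg Sg'; have [Q Qle QE] := diff _ _ _ _ Sg Sg'.
  have [a12 _ _] := Sg; have [a12' _ _] := Sg'.
  have uu' : `|g 0 i - g' 0 i| <= D * (4 * `|a - a'| + 4 * off_axis i g g').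
    apply: norm_div_bound (axis2 _ _ _ _ Sg Sg') D0 _; rewrite QE.
    apply: le_trans (ler_normB _ _) (lerD _ Qle).
    by rewrite normrM mulrC ler_wpM2r // ger0_norm; lra.
  have -> : a * g' 0 i - a' * g 0 i =
    (a - a') * g' 0 i - a' * (g 0 i - g' 0 i) by ring.
  apply: le_trans (ler_normB _ _) _; rewrite !normrM.
  rewrite [ `|a'| ]ger0_norm; last by lra.
  have := coord _ _ i Sg'; have := normr_ge0 (a - a'); have := off0 g g'.
  move: (off_axis i g g') `|a - a'| `|g' 0 i| `|g 0 i - g' 0 i| uu'.
  move=> Delta A u r rle Delta0 A0 u2.
  have Au : A * u <= 2 * (D * A) by nra.
  have E0 : 0 <= D * (4 * A + 4 * Delta).
    by rewrite mulr_ge0 // addr_ge0 ?mulr_ge0.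
  have ar : a' * r <= 2 * (D * (4 * A + 4 * Delta)).
    apply: (@le_trans _ _ (a' * (D * (4 * A + 4 * Delta)))).
      by rewrite ler_wpM2l //; lra.
    by rewrite ler_wpM2r //; lra.
  have DD : 0 <= D * Delta by rewrite mulr_ge0.
  by lra.
exists (fun a g => a / g 0 i); split.
- move=> a g Sg; have [a12 _ _] := Sg; have Dg := axis1 _ _ Sg.
  have D3 : 1 <= D ^+ 3 by rewrite exprn_ege1.
  have g0 := axis_neq0 _ _ Sg.
  split=> [|k]; last by apply: le_trans (coord _ _ k Sg) _; lra.
  apply: le_trans (norm_div_bound _ (g 0 i) D 2 Dg D0 _) _.
    by rewrite divfK // ger0_norm; lra.
  by rewrite exprSr; have := ler_wpM2r D0 (exprn_ege1 2 D1); lra.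
- move=> a g a' g' Sg Sg'; have Dg := axis1 _ _ Sg; have Dg' := axis1 _ _ Sg'.
  have g0 := axis_neq0 _ _ Sg.
  have g0' := axis_neq0 _ _ Sg'.
  apply: le_trans (norm_div_bound _ (g 0 i * g' 0 i) (D ^+ 2) _ _ D2 _) _.
  + by rewrite normrM expr2 mulrACA -[1]mulr1 ler_pM.
  + have -> : (a / g 0 i - a' / g' 0 i) * (g 0 i * g' 0 i) =
      a * g' 0 i - a' * g 0 i by field; rewrite g0 g0'.
    exact: cross Sg Sg'.
  + rewrite mulrA ler_wpM2r ?addr_ge0 // [D ^+ 3]exprSr.
    by have := mulr_ge0 D2 D0; lra.
- move=> a g a' g' Sg Sg'; have Dg := axis1 _ _ Sg.
  have g0 := axis_neq0 _ _ Sg.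
  have [Q Qle QE] := diff _ _ _ _ Sg Sg'.
  have [a12 _ _] := Sg; have [a12' _ _] := Sg'.
  apply: le_trans (norm_div_bound _ (g 0 i * (g 0 i + g' 0 i)) (D ^+ 2)
    (`|a - a'| * (10 * D * (off_axis i g g' + `|a - a'|))
      + 8 * off_axis i g g') _ D2 _) _.
  + by rewrite normrM expr2 mulrACA -[1]mulr1 ler_pM ?(axis2 _ _ _ _ Sg Sg').
  (* With denominators cleared, the term free of [Q] has the factor [a' - a] and a second factor
     that [cross] bounds, which yields the quadratic error. *)
  + have -> : (g 0 i - g' 0 i - a / g 0 i * (a - a')) *
        (g 0 i * (g 0 i + g' 0 i)) =
        (a' - a) * (a * g' 0 i - a' * g 0 i) - Q * g 0 i.
      rewrite mulrBl [X in X - _]mulrCA QE; by field.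
    apply: le_trans (ler_normB _ _) _; rewrite !normrM distrC; apply: lerD.
      by rewrite ler_wpM2l // cross.
    by apply: le_trans (ler_pM _ _ Qle (coord _ _ i Sg)) _ => //; lra.
  (* Since [|a - a'| <= 1], the mixed product is absorbed by the off-axis term; 18 is 10 from
     [cross] plus 8 from [Q]. *)
  + have A1 : `|a - a'| <= 1 by rewrite ler_norml; lra.
    have := normr_ge0 (a - a'); have := off0 g g'.
    move: (off_axis i g g') `|a - a'| A1 => Delta A A1 Delta0 A0.
    have -> : 18 * D ^+ 3 * (Delta + A ^+ 2) =
      D ^+ 2 * (18 * D * (Delta + A ^+ 2)) by ring.
    rewrite ler_wpM2l //.
    have h1 : A * (Delta + A) <= Delta + A ^+ 2 by nra.
    have h2 : Delta <= D * Delta by rewrite ler_peMl.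
    have h3 := ler_wpM2l D0 h1.
    have h4 : 0 <= D * A ^+ 2 by rewrite mulr_ge0 ?sqr_ge0.
    by lra.
Qed.

End Families.


(** * The bound for each family and the conclusion *)

Lemma sphere_sweep (R : realType) n : exists2 C : R, 0 <= C &
  forall delta, 0 < delta < 1 / 2 ->
  thin_sweep (@sphere R n) (C * `|ln delta|^-1) delta.
Proof.
have d0 : (0 < n + 1)%N by rewrite addn1.
apply: (sweep (18 * (2 * (n + 1))%:R ^+ 3) _ fst (sphere_sheet (n + 1))) => //.
- exact: sphere_sheetP.
- move=> a a12 g ga; apply: sphere_sheet_cover => //.
  rewrite -ga enorm_sqr big_split_ord /= big_ord1 /ypart mxE.
  by congr (_ + _); apply: eq_bigr => k _; rewrite mxE.
Qed.

Lemma graph_sweep (R : realType) n (phi : 'rV[R]_n -> R) :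
  (forall X, enorm X <= 1 -> 0 <= phi X <= 1) ->
  (forall X X', enorm X <= 1 -> enorm X' <= 1 ->
    `|phi X - phi X'| <= 2 * `|enorm X - enorm X'|) ->
  exists2 C : R, 0 <= C & forall delta, 0 < delta < 1 / 2 ->
  thin_sweep (fun a => [set p : 'rV[R]_(n + 1) |
      ypart p = a * phi (Xpart p) /\ enorm (Xpart p) <= 1])
    (C * `|ln delta|^-1) delta.
Proof.
move=> phi01 phi_lip; have d0 : (0 < n + 1)%N by rewrite addn1.
have S := graph_sheet n phi phi01 phi_lip.
by apply: (sweep 4 unit _ _ _ d0 _ (fun=> S)) => // a a12 g Gg; exists tt.
Qed.

Theorem theorem1p14 (R : realType) (n : nat) (hn : (2 <= n)%N) :
  exists C : R,
  forall Gamma : R -> set 'rV[R]_(n.-1 + 1),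
    [\/ Gamma = @sphere R n.-1,
        Gamma = @paraboloid R n.-1
      | Gamma = @cone R n.-1] ->
  forall delta : R, 0 < delta < 1 / 2 ->
  exists E : set 'rV[R]_(n.-1 + 1),
    [/\ compact E,
        forall a : R, 1 <= a <= 2 ->
          exists t : 'rV[R]_(n.-1 + 1), [set t + x | x in Gamma a] `<=` E
      & (lebesgue_rV (neighbourhood E delta) <= (C * `|ln delta|^-1)%:E)%E].
Proof.
have [C1 C10 H1] := sphere_sweep R n.-1.
have [C2 C20 H2] : exists2 C : R, 0 <= C & forall delta, 0 < delta < 1 / 2 ->
    thin_sweep (@paraboloid R n.-1) (C * `|ln delta|^-1) delta.
  apply: (graph_sweep R n.-1 (fun X => enorm X ^+ 2)) => [X X1|X X' X1 X1'].
    by rewrite sqr_ge0 expr_le1 ?enorm_ge0.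
  rewrite subr_sqr normrM mulrC ler_wpM2r // ger0_norm ?addr_ge0 ?enorm_ge0 //.
  by lra.
have [C3 C30 H3] : exists2 C : R, 0 <= C & forall delta, 0 < delta < 1 / 2 ->
    thin_sweep (@cone R n.-1) (C * `|ln delta|^-1) delta.
  apply: (graph_sweep R n.-1 (@enorm R n.-1)) => [X X1|X X' X1 X1'].
    by rewrite enorm_ge0.
  by rewrite ler_peMl // ler1n.
(* The constant precedes the choice of family; as all three are nonnegative, their sum dominates
   each. *)
exists (C1 + C2 + C3) => Gamma GE delta delta12.
have ln0 : 0 <= `|ln delta|^-1 by rewrite invr_ge0.
have [C CC [E [cE sE mE]]] : exists2 C, C <= C1 + C2 + C3 &
    thin_sweep Gamma (C * `|ln delta|^-1) delta.
  case: GE => ->.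
  - by exists C1; [lra|exact: H1].
  - by exists C2; [lra|exact: H2].
  - by exists C3; [lra|exact: H3].
exists E; split => //; apply: le_trans mE _.
by rewrite lee_fin ler_wpM2r.
Qed.
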